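(* Let $\widehat{A}=A+\varepsilon B$ be an $n\times n$ dual matrix with $A,B\in\mathbb{R}^{n\times n}$. Then the dual group generalized inverse $\widehat{A}^{\#}$ exists and $\widehat{A}^{\#}=A^{\#}-\varepsilon A^{\#}BA^{\#}$ if and only if $\mathrm{Ind}(A)=1$, the dual Moore–Penrose generalized inverse $\widehat{A}^{+}$ exists, and $\widehat{A}^{+}=A^{+}-\varepsilon A^{+}BA^{+}$.
   Context: Dual numbers are $a+\varepsilon a'$ with $a,a'\in\mathbb{R}$ and $\varepsilon\neq 0$, $\varepsilon^2=0$ (i.e. the ring $\mathbb{R}[\varepsilon]/(\varepsilon^2)$). A dual matrix is a matrix over dual numbers, written $\widehat{A}=A+\varepsilon B$ with $A,B$ real; its transpose is $\widehat{A}^{T}=A^{T}+\varepsilon B^{T}$. For an $n\times n$ dual matrix $\widehat{A}$ (each inverse below is unique when it exists): the dual group generalized inverse (DGGI) $\widehat{A}^{\#}$ is the $\widehat{G}$ with $\widehat{A}\widehat{G}\widehat{A}=\widehat{A}$, $\widehat{G}\widehat{A}\widehat{G}=\widehat{G}$, $\widehat{A}\widehat{G}=\widehat{G}\widehat{A}$; the dual Moore–Penrose generalized inverse (DMPGI) $\widehat{A}^{+}$ is the $\widehat{X}$ with $\widehat{A}\widehat{X}\widehat{A}=\widehat{A}$, $\widehat{X}\widehat{A}\widehat{X}=\widehat{X}$, $(\widehat{A}\widehat{X})^{T}=\widehat{A}\widehat{X}$, $(\widehat{X}\widehat{A})^{T}=\widehat{X}\widehat{A}$. For a real square matrix $A$,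 $A^{+}$ is its Moore–Penrose inverse, ''$\mathrm{Ind}(A)=1$'' means $\mathrm{rank}(A^2)=\mathrm{rank}(A)$, and in that case $A^{\#}$ is the group inverse (the unique real $X$ with $AXA=A$, $XAX=X$, $AX=XA$). *)

(* Defs.v *)
From mathcomp Require Import all_boot all_order all_algebra.
From mathcomp Require Import boolp classical_sets reals.

Set Implicit Arguments.
Unset Strict Implicit.
Unset Printing Implicit Defensive.

Import GRing.Theory.
Local Open Scope ring_scope.
Local Open Scope classical_set_scope.

Notation dual R := {poly %/ ('X^2 : {poly R})}.

Definition dual_eps (R : comNzRingType) : dual R := 'qX.

Definition real_mx (R : comNzRingType) m n (A : 'M[R]_(m, n)) :
  'M[dual R]_(m, n) := map_mx (qpolyC 'X^2) A.

Definition dual_mx (R : comNzRingType) m n (A B : 'M[R]_(m, n)) :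
  'M[dual R]_(m, n) := real_mx A + dual_eps R *: real_mx B.

(* The generalized inverses are defined over any commutative ring, and used
   both for real matrices and for dual ones. *)
Section GeneralizedInverses.
Variables (R : comNzRingType) (n : nat).
Implicit Types A G X : 'M[R]_n.

Definition is_group_inverse A G :=
  [/\ A *m G *m A = A, G *m A *m G = G & A *m G = G *m A].

Definition is_mp_inverse A X :=
  [/\ A *m X *m A = A, X *m A *m X = X,
      (A *m X)^T = A *m X & (X *m A)^T = X *m A].

Definition has_group_inverse A := exists G, is_group_inverse A G.

Definition has_mp_inverse A := exists X, is_mp_inverse A X.

(* Both operations return 0 on a matrix that has no such inverse. *)
Definition group_inverse A : 'M[R]_n := xget 0 [set G | is_group_inverse A G].

Definition mp_inverse A : 'M[R]_n := xget 0 [set X | is_mp_inverse A X].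

Lemma is_group_inverse_unique A G1 G2 :
  is_group_inverse A G1 -> is_group_inverse A G2 -> G1 = G2.
Proof.
move=> [a1 b1 c1] [a2 b2 c2].
have e : A *m G1 = A *m G2.
  by rewrite -[in LHS]a2 c2 -mulmxA c1 -mulmxA (mulmxA A) a1.
by rewrite -b1 -mulmxA e mulmxA -c1 e c2 b2.
Qed.

Lemma is_mp_inverse_unique A X1 X2 :
  is_mp_inverse A X1 -> is_mp_inverse A X2 -> X1 = X2.
Proof.
move=> [a1 b1 c1 d1] [a2 b2 c2 d2].
have e : A *m X1 = A *m X2.
  by rewrite -c1 -[in LHS]a2 -mulmxA trmx_mul c1 c2 mulmxA a1.
have f : X1 *m A = X2 *m A.
  by rewrite -d1 -[in LHS]a2 -mulmxA mulmxA trmx_mul d1 d2 -mulmxA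
    (mulmxA A) a1.
by rewrite -b1 f -mulmxA e mulmxA b2.
Qed.

Lemma group_inverseE A G : is_group_inverse A G -> group_inverse A = G.
Proof.
by move=> AG; apply: xget_unique => // G' /is_group_inverse_unique; apply.
Qed.

Lemma mp_inverseE A X : is_mp_inverse A X -> mp_inverse A = X.
Proof.
by move=> AX; apply: xget_unique => // X' /is_mp_inverse_unique; apply.
Qed.

End GeneralizedInverses.

(* Ind(A) = 1 in the sense rank(A^2) = rank(A), so that an invertible matrix
   and the zero matrix satisfy it. *)
Definition index1 (R : fieldType) n (A : 'M[R]_n) : Prop :=
  \rank (A *m A) = \rank A.

Section DualMatrices.
Variable R : comNzRingType.

Lemma dual_eps2 : dual_eps R * dual_eps R = 0.
Proof.
rewrite /dual_eps /qpolyX -in_qpolyM -expr2; apply: val_inj => /=.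
by rewrite mk_monic_Xn /= Pdiv.RingMonic.rmodpp ?monicXn.
Qed.

Lemma dual_mxM m n p (A B : 'M[R]_(m, n)) (C D : 'M[R]_(n, p)) :
  dual_mx A B *m dual_mx C D = dual_mx (A *m C) (A *m D + B *m C).
Proof.
rewrite /dual_mx /real_mx !map_mxD !map_mxM !mulmxDl !mulmxDr.
rewrite -!scalemxAl -!scalemxAr scalerA dual_eps2 scale0r addr0 -addrA.
by rewrite scalerDr.
Qed.

Lemma trmx_dual m n (A B : 'M[R]_(m, n)) :
  (dual_mx A B)^T = dual_mx A^T B^T.
Proof. by apply/matrixP => i j; rewrite !mxE. Qed.

Lemma coef_dual_mx m n (A B : 'M[R]_(m, n)) i j :
  (dual_mx A B i j : {poly R}) = (A i j)%:P + (B i j)%:P * 'X.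
Proof.
rewrite !mxE poly_of_qpolyD poly_of_qpolyM /dual_eps qpolyXE ?monicXn //;
  last by rewrite size_polyXn.
rewrite Pdiv.CommonRing.rmodp_small /=; first by rewrite mulrC.
rewrite mk_monic_Xn size_polyXn mulrC.
apply: leq_ltn_trans (size_polyMleq _ _) _.
by rewrite size_polyX size_polyC; case: eqP.
Qed.

Lemma dual_mx_inj m n (A B C D : 'M[R]_(m, n)) :
  dual_mx A B = dual_mx C D -> A = C /\ B = D.
Proof.
move=> e; split; apply/matrixP => i j;
  move/(congr1 (fun M : 'M[dual R]_(m, n) => (M i j : {poly R}))): e;
  rewrite !coef_dual_mx => e.
  by move/(congr1 (fun p : {poly R} => p`_0)): e;
  rewrite !coefD !coefMX !coefC /= !addr0.
by move/(congr1 (fun p : {poly R} => p`_1)): e;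
  rewrite !coefD !coefMX !coefC /= !add0r.
Qed.

Lemma dual_mx_surj m n (M : 'M[dual R]_(m, n)) :
  exists A B, M = dual_mx A B.
Proof.
exists (\matrix_(i, j) (M i j : {poly R})`_0),
       (\matrix_(i, j) (M i j : {poly R})`_1).
apply/matrixP => i j; apply: val_inj => /=.
apply/polyP => k; rewrite [in RHS]coef_dual_mx !mxE coefD coefMX !coefC.
case: k => [|[|k]] /=; rewrite ?addr0 ?add0r // nth_default //.
apply: leq_trans (_ : _ <= 2)%N _ => //.
rewrite -ltnS; apply: leq_trans (size_mk_monic (M i j)) _.
by rewrite mk_monic_Xn size_polyXn.
Qed.

End DualMatrices.

(* Main.v *)
(** A generalized inverse of the form [X - eps X B X] of [A + eps B] forces
    [X] to be the corresponding inverse of [A]; splitting the remaining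
    [eps]-part along the projections [A X] and [X A] then yields
    [A X B = B = B X A].  This says that [B] factors through [A] on both sides,
    a condition that does not depend on the choice of the inner inverse [X],
    so it is the same for [A^#] and [A^+].  What remains is that [A^#] exists
    exactly when [Ind(A) = 1], and that a real matrix always has [A^+]. *)
Require Import Defs.
From mathcomp Require Import all_boot all_order all_algebra.
From mathcomp Require Import reals.

Set Implicit Arguments.
Unset Strict Implicit.
Unset Printing Implicit Defensive.

Import GRing.Theory Num.Theory.
Local Open Scope ring_scope.

(** [A Y B = B] puts [B] in the column space of [A], on which [A X] acts as the identity. *)
Lemma inner_inverse_fixl (R : comNzRingType) n p (A X Y : 'M[R]_n)
    (B : 'M[R]_(n, p)) :
  A *m X *m A = A -> A *m Y *m B = B -> A *m X *m B = B.
Proof. by move=> AXA AYB; rewrite -AYB !mulmxA AXA. Qed.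

Lemma inner_inverse_fixr (R : comNzRingType) n p (A X Y : 'M[R]_n)
    (B : 'M[R]_(p, n)) :
  A *m X *m A = A -> B *m Y *m A = B -> B *m X *m A = B.
Proof.
move=> AXA BYA; rewrite -[in LHS]BYA.
by rewrite -mulmxA -mulmxA (mulmxA A) AXA.
Qed.

Lemma real_mxB_eps (R : comNzRingType) m n (A B : 'M[R]_(m, n)) :
  real_mx A - dual_eps R *: real_mx B = dual_mx A (- B).
Proof. by rewrite /dual_mx /real_mx map_mxN scalerN. Qed.

(** By [A X B = B] the first two factors multiply to the real matrix [A X], which fixes both [A] and
    [B]. *)
Lemma dual_inner_inverse (R : comNzRingType) n (A B X : 'M[R]_n) :
  A *m X *m A = A -> A *m X *m B = B ->
  dual_mx A B *m dual_mx X (- (X *m B *m X)) *m dual_mx A B = dual_mx A B.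
Proof.
move=> AXA AXB; rewrite !dual_mxM AXA mulmxN !mulmxA AXB addNr mul0mx.
by rewrite addr0.
Qed.

Lemma dual_outer_inverse (R : comNzRingType) n (A B X : 'M[R]_n) :
  X *m A *m X = X -> A *m X *m B = B ->
  dual_mx X (- (X *m B *m X)) *m dual_mx A B *m dual_mx X (- (X *m B *m X)) =
  dual_mx X (- (X *m B *m X)).
Proof.
move=> XAX AXB; rewrite !dual_mxM XAX mulmxN mulNmx !mulmxA XAX mulmxDl.
by rewrite mulNmx -(mulmxA _ A X) -(mulmxA _ X) (mulmxA X A) XAX subrr addr0.
Qed.

(** The last two hypotheses make [A X B] and [B X A] both equal to [A X B X A], so the first
    collapses. *)
Lemma dual_inner_inverse_fix (R : comNzRingType) n (A B X : 'M[R]_n) :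
  B = A *m X *m B + B *m X *m A - A *m X *m B *m X *m A ->
  B *m X = A *m X *m B *m X -> X *m B = X *m B *m X *m A ->
  A *m X *m B = B /\ B *m X *m A = B.
Proof.
move=> eB BX XB.
have e1 : B *m X *m A = A *m X *m B *m X *m A by rewrite -BX.
have e2 : A *m X *m B = A *m X *m B *m X *m A.
  by rewrite -[LHS]mulmxA XB !mulmxA.
by split; rewrite [RHS]eB e1 addrK // -e2.
Qed.

Lemma is_group_inverse_dual (R : comNzRingType) n (A B G : 'M[R]_n) :
  is_group_inverse (dual_mx A B) (dual_mx G (- (G *m B *m G))) <->
  [/\ is_group_inverse A G, A *m G *m B = B & B *m G *m A = B].
Proof.
split=> [[]|[[AGA GAG AG] AGB BGA]]; last first.
  split; [exact: dual_inner_inverse|exact: dual_outer_inverse|].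
  rewrite !dual_mxM AG mulmxN mulNmx !mulmxA AGB addNr.
  by rewrite -2!(mulmxA G) BGA subrr.
rewrite !dual_mxM => /dual_mx_inj[AGA eB] /dual_mx_inj[GAG _] /dual_mx_inj[AG eC].
have e : B *m G - A *m G *m B *m G = G *m B - G *m B *m G *m A.
  by move: eC; rewrite mulmxN mulNmx !mulmxA addrC.
(* [A G] kills the left side of [e] and fixes the right one. *)
have eG : G *m B = G *m B *m G *m A.
  move/(congr1 (mulmx (A *m G))): e.
  by rewrite !mulmxBr !mulmxA AGA subrr AG GAG => /esym/subr0_eq.
have eBG : B *m G = A *m G *m B *m G.
  by apply/eqP; rewrite -subr_eq0 e -eG subrr.
have {}eB : B = A *m G *m B + B *m G *m A - A *m G *m B *m G *m A.
  rewrite -[LHS]eB mulmxN mulmxDl mulNmx !mulmxA.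
  by rewrite -addrA [X in _ + X]addrC.
by have [AGB BGA] := dual_inner_inverse_fix eB eBG eG.
Qed.

Lemma is_mp_inverse_dual (R : comNzRingType) n (A B X : 'M[R]_n) :
  is_mp_inverse (dual_mx A B) (dual_mx X (- (X *m B *m X))) <->
  [/\ is_mp_inverse A X, A *m X *m B = B & B *m X *m A = B].
Proof.
split=> [[]|[[AXA XAX AX XA] AXB BXA]]; last first.
  split; [exact: dual_inner_inverse|exact: dual_outer_inverse| |].
    by rewrite !dual_mxM mulmxN !mulmxA AXB addNr trmx_dual AX trmx0.
  rewrite !dual_mxM mulNmx -2!(mulmxA X) BXA subrr.
  by rewrite trmx_dual XA trmx0.
rewrite !dual_mxM !trmx_dual.
move=> /dual_mx_inj[AXA eB] /dual_mx_inj[XAX _].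
move=> /dual_mx_inj[AX eAX] /dual_mx_inj[XA eXA].
(* A symmetric matrix killed on the left by [A X] and fixed on the right by it
   is zero. *)
have eBX : B *m X = A *m X *m B *m X.
  apply/eqP; rewrite -subr_eq0 -[X in X == 0]trmxK.
  have e : (B *m X - A *m X *m B *m X)^T = B *m X - A *m X *m B *m X.
    by move: eAX; rewrite mulmxN !mulmxA addrC.
  have eX : (B *m X - A *m X *m B *m X) *m (A *m X) =
            B *m X - A *m X *m B *m X.
    by rewrite mulmxBl -!(mulmxA _ X) !(mulmxA X A) XAX.
  rewrite e -[X in X^T]eX trmx_mul AX e mulmxBr !mulmxA AXA.
  by rewrite subrr.
(* Mirror image: [X B - X B X A] is symmetric, fixed by [X A] on the left and killed by it on the
   right. *)
have eXB : X *m B = X *m B *m X *m A.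
  apply/eqP; rewrite -subr_eq0 -[X in X == 0]trmxK.
  have e : (X *m B - X *m B *m X *m A)^T = X *m B - X *m B *m X *m A.
    by move: eXA; rewrite mulNmx.
  have eX : X *m A *m (X *m B - X *m B *m X *m A) =
            X *m B - X *m B *m X *m A.
    by rewrite mulmxBr !mulmxA XAX.
  rewrite e -[X in X^T]eX trmx_mul XA e mulmxBl -!mulmxA (mulmxA A) AXA.
  by rewrite subrr.
have {}eB : B = A *m X *m B + B *m X *m A - A *m X *m B *m X *m A.
  rewrite -[LHS]eB mulmxN mulmxDl mulNmx !mulmxA.
  by rewrite -addrA [X in _ + X]addrC.
by have [AXB BXA] := dual_inner_inverse_fix eB eBX eXB.
Qed.

(** Equal ranks give [A] and [A^2] the same row space and the same column space, so
    [A = U A^2 = A^2 V]; the group inverse is then [U A V]. *)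
Lemma index1_has_group_inverse (F : fieldType) n (A : 'M[F]_n) :
  index1 A -> has_group_inverse A.
Proof.
rewrite /index1 => rA.
have /submxP[U eU] : (A <= A *m A)%MS.
  by rewrite -(mxrank_leqif_sup (submxMl A A)).2 rA.
have /submxP[V eV] : (A^T <= A^T *m A^T)%MS.
  by rewrite -(mxrank_leqif_sup (submxMl _ _)).2 -trmx_mul !mxrank_tr rA.
have {}eV : A = A *m A *m V^T by rewrite -[LHS]trmxK eV !trmx_mul !trmxK.
move: V^T eV => {}V eV; rewrite mulmxA in eU.
(* Both sides equal [U A^2 V]. *)
have UA : U *m A = A *m V by rewrite {1}eV !mulmxA -eU.
have AG : A *m (U *m A *m V) = A *m V by rewrite UA !mulmxA -eV.
have GA : U *m A *m V *m A = A *m V.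
  by rewrite -(mulmxA U) -UA -!mulmxA (mulmxA U A) -eU.
exists (U *m A *m V); split.
- by rewrite AG -UA -eU.
- by rewrite GA -UA -[LHS]mulmxA AG mulmxA.
- by rewrite AG GA.
Qed.

(** Commutation turns [A = A G A] into [A = G A^2], so the row space of [A] lies in that of
    [A^2]. *)
Lemma has_group_inverse_index1 (F : fieldType) n (A : 'M[F]_n) :
  has_group_inverse A -> index1 A.
Proof.
move=> [G [AGA _ AG]]; apply/eqP.
by rewrite (mxrank_leqif_sup (submxMl A A)).2 -{1}AGA AG -mulmxA submxMl.
Qed.

(** The diagonal entries of [A A^T] are sums of squares of the entries of a row. *)
Lemma mulmx_tr_eq0 (F : realFieldType) m n (A : 'M[F]_(m, n)) :
  A *m A^T = 0 -> A = 0.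
Proof.
move=> AA0; apply/matrixP => i j; rewrite mxE.
have /eqP := congr1 (fun M : 'M_m => M i i) AA0; rewrite !mxE.
rewrite psumr_eq0 => [/allP/(_ j)|k _]; last by rewrite mxE -expr2 sqr_ge0.
by rewrite mem_index_enum mxE -expr2 sqrf_eq0 => /(_ isT)/eqP.
Qed.

Lemma mxrank_mul_tr (F : realFieldType) m n (A : 'M[F]_(m, n)) :
  \rank (A *m A^T) = \rank A.
Proof.
rewrite -(mxrank_mul_ker A A^T); apply/esym/eqP.
(* The rank lost is that of [K], the row space of [A] met with the kernel of [A^T]. From [K = W A]
   and [K A^T = 0] follows [K K^T = 0]. *)
rewrite -[X in _ == X]addn0 eqn_add2l mxrank_eq0; set K := (A :&: _)%MS.
have /submxP[W eW] : (K <= A)%MS by exact: capmxSl.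
have /sub_kermxP K0 : (K <= kermx A^T)%MS by exact: capmxSr.
by apply/eqP/mulmx_tr_eq0; rewrite [in X in _ *m X]eW trmx_mul mulmxA K0 mul0mx.
Qed.

Lemma is_group_inverse_tr (R : comNzRingType) n (A G : 'M[R]_n) :
  is_group_inverse A G -> is_group_inverse A^T G^T.
Proof.
move=> [AGA GAG AG].
by split; rewrite -!trmx_mul ?mulmxA ?AGA ?GAG // AG.
Qed.

(* [A^+ = A^T (A A^T)^#], where [A A^T] has index 1 because it is symmetric. *)
Lemma real_has_mp_inverse (F : realFieldType) n (A : 'M[F]_n) :
  has_mp_inverse A.
Proof.
have HT : (A *m A^T)^T = A *m A^T by rewrite trmx_mul trmxK.
have [K HK] : has_group_inverse (A *m A^T).
  apply: index1_has_group_inverse.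
  by have := mxrank_mul_tr (A *m A^T); rewrite HT.
(* [K^T] is a group inverse of the same symmetric matrix, so uniqueness applies. *)
have KT : K^T = K.
  apply: is_group_inverse_unique (HK).
  by rewrite -HT; apply: is_group_inverse_tr.
case: HK => HKH KHK HK; exists (A^T *m K); split.
(* The difference [Z] of the two sides satisfies [Z A^T = 0], and [Z^T] has [A^T] as a left factor,
   so [Z Z^T = 0]. *)
- apply/eqP; rewrite -subr_eq0; apply/eqP/mulmx_tr_eq0.
  have Z0 : (A *m (A^T *m K) *m A - A) *m A^T = 0.
    by rewrite mulmxBl (mulmxA A A^T) -(mulmxA _ A A^T) HKH subrr.
  by rewrite [in X in _ *m X]raddfB /= trmx_mul mulmxBr mulmxA Z0 mul0mx subrr.
- have -> : A^T *m K *m A *m (A^T *m K) = A^T *m (K *m (A *m A^T) *m K).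
    by rewrite !mulmxA.
  by rewrite KHK.
- by rewrite mulmxA trmx_mul KT HT HK.
- by rewrite !trmx_mul KT trmxK mulmxA.
Qed.

Theorem theorem3p12 (R : realType) (n : nat) (A B : 'M[R]_n) :
  (has_group_inverse (dual_mx A B) /\
   group_inverse (dual_mx A B) =
     real_mx (group_inverse A)
       - dual_eps R *: real_mx (group_inverse A *m B *m group_inverse A))
  <->
  (index1 A /\
   has_mp_inverse (dual_mx A B) /\
   mp_inverse (dual_mx A B) =
     real_mx (mp_inverse A)
       - dual_eps R *: real_mx (mp_inverse A *m B *m mp_inverse A)).
Proof.
rewrite !real_mxB_eps; split.
(* Existence rules out the default value 0 of [group_inverse], so the formula gives a true inverse
   of the dual matrix, and its real part shows that [group_inverse A] is one of [A]. *)
- move=> [[G' hG'] eG]; have := hG'; rewrite -(group_inverseE hG') eG.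
  move=> /is_group_inverse_dual[hG AGB BGA].
  have [X hX] := real_has_mp_inverse A; have [AXA _ _ _] := hX.
  rewrite (mp_inverseE hX).
  have hD : is_mp_inverse (dual_mx A B) (dual_mx X (- (X *m B *m X))).
    apply/is_mp_inverse_dual; split=> //.
      exact: inner_inverse_fixl AGB.
    exact: inner_inverse_fixr BGA.
  split; first by apply: has_group_inverse_index1; exists (group_inverse A).
  by split; [exists (dual_mx X (- (X *m B *m X)))|exact: mp_inverseE].
- move=> [iA [[X' hX'] eX]]; have := hX'; rewrite -(mp_inverseE hX') eX.
  move=> /is_mp_inverse_dual[_ AXB BXA].
  (* Here [Ind(A) = 1] supplies the real inverse to which the conditions on [B] are transferred. *)
  have [G hG] := index1_has_group_inverse iA; have [AGA _ _] := hG.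
  rewrite (group_inverseE hG).
  have hD : is_group_inverse (dual_mx A B) (dual_mx G (- (G *m B *m G))).
    apply/is_group_inverse_dual; split=> //.
      exact: inner_inverse_fixl AXB.
    exact: inner_inverse_fixr BXA.
  by split; [exists (dual_mx G (- (G *m B *m G)))|exact: group_inverseE].
Qed.
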